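(* Let $v\ge 4$ be an integer with $v\not\equiv 2\pmod 4$. Then there exists an AOA$(1,3,5,v)$.
   Context: An orthogonal array OA$(t,k,v)$ (with $1\le t\le k$) is a $v^t\times k$ array with entries from a set $X$ of size $v$ such that, for every choice of $t$ of its columns, each $t$-tuple in $X^t$ appears exactly once as a row of the corresponding $v^t\times t$ subarray. For integers $1\le s\le t\le k$, an augmented orthogonal array AOA$(s,t,k,v)$ is a $v^t\times(k+1)$ array $A$ such that: (1) the first $k$ columns of $A$ form an OA$(t,k,v)$ on a symbol set $X$ of size $v$; (2) the last column of $A$ has entries from a set $Y$ of size $v^{t-s}$; (3) for any choice of $s$ of the first $k$ columns, these $s$ columns together with the last column contain every $(s+1)$-tuple of $X^s\times Y$ exactly once as a row. *)

(* Defs.v *)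
From mathcomp Require Import all_boot.
Unset Printing Implicit Defensive.

(* A v^t x k array with entries in X = 'I_v: rows indexed by 'I_(v^t),
   entry in row r and column j is A r j.
   "For every choice of t columns" is rendered as: for every injective
   c : 'I_t -> 'I_k (an ordered choice of t distinct columns). *)
Definition is_OA (t k v : nat) (A : 'I_(v ^ t) -> 'I_k -> 'I_v) : Prop :=
  forall c : 'I_t -> 'I_k, injective c ->
  forall x : 'I_t -> 'I_v,
    exists! r : 'I_(v ^ t), forall i : 'I_t, A r (c i) = x i.

Definition is_AOA (s t k v : nat)
    (A : 'I_(v ^ t) -> 'I_k -> 'I_v) (L : 'I_(v ^ t) -> 'I_(v ^ (t - s))) : Prop :=
  is_OA t k v A /\
  forall c : 'I_s -> 'I_k, injective c ->
  forall (x : 'I_s -> 'I_v) (y : 'I_(v ^ (t - s))),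
    exists! r : 'I_(v ^ t), (forall i : 'I_s, A r (c i) = x i) /\ L r = y.

Definition AOA_exists (s t k v : nat) : Prop :=
  exists (A : 'I_(v ^ t) -> 'I_k -> 'I_v) (L : 'I_(v ^ t) -> 'I_(v ^ (t - s))),
    is_AOA s t k v A L.

(* Main.v *)
(** A difference matrix over an abelian group G of order v has four rows
    d0, ..., d3 and v columns, the difference of any two rows being a bijection
    onto G.  It yields the orthogonal array of strength 3 whose row (x, y, j) is
      x + d0 j,  x + d1 j,  y - d2 j,  y - d3 j,  x + y;
    eliminating x and y from any three of these entries leaves, up to sign, a
    difference of two rows of d, which determines j.
    The last column is (y - a x, j), where a carries d0 - d1 to d1 - d2, so that
    both a and x |-> x + a x (which carries d0 - d1 to d0 - d2) are bijections.

    Difference matrices multiply, so write v = 2^b 3^c m with m prime to 6.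
    Fields give the prime powers >= 4, and the rows 0, j, 2j, 3j give m.  For
    c = 1, take over Z_3 x Z_m the columns
      (0, 0),  (p, n),  (q, 2n - e),  (r, 3n)      (n in Z_m, e in {0, 1, 2}):
    they form a difference matrix as soon as the p, q, r of n, n + 1 and n + 2
    satisfy finitely many inequalities, i.e. as soon as the states of the n's
    form a closed walk of length m in a fixed graph.  That graph has
    closed walks of length 2 and 5 through a common edge, hence of every odd
    length >= 5.  Only the orders 12 and 24 remain. *)

Require Import Defs.
From HB Require Import structures.
From mathcomp Require Import all_boot all_algebra all_field ring.

Set Implicit Arguments.
Unset Strict Implicit.
Unset Printing Implicit Defensive.

Import GRing.Theory.

(** * Augmented orthogonal arrays from injectivity and counting *)

Lemma inj_exists_unique (T T' : finType) (f : T -> T') :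
  injective f -> #|T'| = #|T| -> forall y, exists! x, f x = y.
Proof.
move=> f_inj cardT y; have /codomP[x def_y] : y \in codom f.
  by apply: inj_card_onto; rewrite // cardT.
by exists x; split=> [|x' fx']; [| apply: f_inj; rewrite fx'].
Qed.

(** There are as many rows as tuples to be covered, so a projection that separates rows hits each
    tuple exactly once. Enumeration transports arbitrary finite types to ordinals. *)
Lemma AOA_of_inj (s t k v : nat) (R X Y : finType)
    (A : R -> 'I_k -> X) (L : R -> Y) :
  s <= t -> #|R| = v ^ t -> #|X| = v -> #|Y| = v ^ (t - s) ->
  (forall c : 'I_t -> 'I_k, injective c ->
     forall r r', (forall i, A r (c i) = A r' (c i)) -> r = r') ->
  (forall c : 'I_s -> 'I_k, injective c ->
     forall r r', (forall i, A r (c i) = A r' (c i)) -> L r = L r' -> r = r') ->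
  AOA_exists s t k v.
Proof.
move=> le_st cardR cardX cardY injA injL.
pose row i := enum_val (cast_ord (esym cardR) i).
pose sym x : 'I_v := cast_ord cardX (enum_rank x).
pose lab y : 'I_(v ^ (t - s)) := cast_ord cardY (enum_rank y).
have row_inj : injective row by move=> i j /enum_val_inj/cast_ord_inj.
have sym_inj : injective sym by move=> i j /cast_ord_inj/enum_rank_inj.
have lab_inj : injective lab by move=> i j /cast_ord_inj/enum_rank_inj.
exists (fun r j => sym (A (row r) j)), (fun r => lab (L (row r))); split=> c c_inj x.
  pose f r := [ffun i => sym (A (row r) (c i))].
  have f_inj : injective f.
    move=> r r' /ffunP eqf; apply/row_inj/(injA c) => // i.
    by apply: sym_inj; have := eqf i; rewrite !ffunE.
  have cardf : #|{ffun 'I_t -> 'I_v}| = #|'I_(v ^ t)| by rewrite card_ffun !card_ord.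
  have [r [fr r_uniq]] := inj_exists_unique f_inj cardf [ffun i => x i].
  exists r; split=> [i | r' Hr']; first by move/ffunP/(_ i): fr; rewrite !ffunE.
  by apply: r_uniq; apply/ffunP=> i; rewrite !ffunE.
move=> y; pose f r := ([ffun i => sym (A (row r) (c i))], lab (L (row r))).
have f_inj : injective f.
  move=> r r' eqf; apply/row_inj/(injL c) => //; last exact/lab_inj/(congr1 snd eqf).
  by move=> i; apply: sym_inj; have /ffunP/(_ i) := congr1 fst eqf; rewrite !ffunE.
have cardf : #|{: {ffun 'I_s -> 'I_v} * 'I_(v ^ (t - s))}| = #|'I_(v ^ t)|.
  by rewrite card_prod card_ffun !card_ord -expnD subnKC.
have [r [fr r_uniq]] := inj_exists_unique f_inj cardf ([ffun i => x i], y).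
exists r; split=> [|r' [HA HL]].
  split=> [i|]; last exact: (congr1 snd fr).
  by have /ffunP/(_ i) := congr1 fst fr; rewrite !ffunE.
by apply: r_uniq; congr pair => //; apply/ffunP=> i; rewrite !ffunE.
Qed.

(** * Difference matrices and the arrays they yield *)

HB.instance Definition _ (G H : finZmodType) := GRing.Zmodule.on (G * H)%type.

Section DifferenceMatrices.

Local Open Scope ring_scope.

Definition difference_matrix (G : finZmodType) (J : finType) (d : 'I_4 -> J -> G) :=
  forall i k : 'I_4, i != k -> injective (fun j => d i j - d k j).

Definition has_difference_matrix (v : nat) :=
  exists (G : finZmodType) (J : finType) (d : 'I_4 -> J -> G),
    [/\ #|G| = v, #|J| = v & difference_matrix d].

Lemma difference_matrix_lt (G : finZmodType) (J : finType) (d : 'I_4 -> J -> G) :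
  (forall i k : 'I_4, (i < k)%N -> injective (fun j => d k j - d i j)) ->
  difference_matrix d.
Proof.
move=> inj_d i k; rewrite neq_ltn => /orP[lt_ik|lt_ki] j j'; last exact: inj_d.
by move/(congr1 -%R); rewrite !opprB; apply: inj_d.
Qed.

Lemma subrDD (V : zmodType) (z x y : V) : (z + x) - (z + y) = x - y.
Proof. by rewrite opprD addrACA subrr add0r. Qed.

Section ArrayOfMatrix.

Variables (G : finZmodType) (J : finType) (d : 'I_4 -> J -> G).
Hypothesis dmd : difference_matrix d.
Hypothesis cardJ : #|J| = #|G|.

Let d0 := d (@Ordinal 4 0 isT).
Let d1 := d (@Ordinal 4 1 isT).
Let d2 := d (@Ordinal 4 2 isT).
Let d3 := d (@Ordinal 4 3 isT).

Definition array_entry (r : G * G * J) (k : 'I_5) : G :=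
  let: (x, y, j) := r in
  nth 0 [:: x + d0 j; x + d1 j; y - d2 j; y - d3 j; x + y] k.

Lemma array_entry_inj (c : 'I_3 -> 'I_5) : injective c ->
  forall r r', (forall i, array_entry r (c i) = array_entry r' (c i)) -> r = r'.
Proof.
move=> c_inj [[x y] j] [[x' y'] j'] eq_r.
pose g k := array_entry (x, y, j) k == array_entry (x', y', j') k.
(* Replaces the maps [c] by the sets of agreeing columns, a finite case analysis. *)
have : (3 <= #|[pred k | g k]|)%N.
  rewrite -[X in (X <= _)%N](card_ord 3) -(card_codom c_inj).
  by apply/subset_leq_card/subsetP=> k /codomP[i ->]; apply/eqP/eq_r.
rewrite -sum1_card big_mkcond !big_ord_recl big_ord0 /= !inE /g /=.
have x_eq f : x + f j = x' + f j' -> j = j' -> x = x'.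
  by move=> eq_f eq_j; move: eq_f; rewrite eq_j; apply: addIr.
have y_eq f : y - f j = y' - f j' -> j = j' -> y = y'.
  by move=> eq_f eq_j; move: eq_f; rewrite eq_j; apply: addIr.
have x_j i k : i != k -> x + d i j = x' + d i j' -> x + d k j = x' + d k j' -> j = j'.
  by move=> ne_ik eq_i eq_k; apply: (dmd ne_ik); rewrite /= -(subrDD x) eq_i eq_k subrDD.
have y_j i k : i != k -> y - d i j = y' - d i j' -> y - d k j = y' - d k j' -> j = j'.
  move=> ne_ik eq_i eq_k; apply: (dmd ne_ik); apply: oppr_inj; rewrite /= !opprB.
  by rewrite !(addrC _ (- d i _)) -(opprK (d k j)) -(opprK (d k j')) -(subrDD y) eq_i eq_k subrDD.
have xy_j i k : i != k -> x + d i j = x' + d i j' -> y - d k j = y' - d k j' ->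
    x + y = x' + y' -> j = j'.
  move=> ne_ik eq_i eq_k eq_xy; apply: (dmd ne_ik); apply: oppr_inj.
  have diff u w l : - (d i l - d k l) = (u + w) - ((u + d i l) + (w - d k l)).
    by rewrite addrACA [in RHS]opprD addrA subrr sub0r.
  by rewrite /= (diff x y) eq_i eq_k eq_xy -diff.
case: eqP => e0; case: eqP => e1; case: eqP => e2; case: eqP => e3; case: eqP => e4 //= _.
(* Three of the five entries include both entries in [x] and [j], or both in [y] and [j], or one of
   each together with [x + y]. *)
all: have eq_j : j = j' by first
  [ exact: x_j e0 e1 | exact: y_j e2 e3 | exact: xy_j e0 e2 e4
  | exact: xy_j e0 e3 e4 | exact: xy_j e1 e2 e4 | exact: xy_j e1 e3 e4 ].
all: have [eq_x | eq_y] : x = x' \/ y = y' by first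
  [ left; exact: x_eq e0 eq_j | left; exact: x_eq e1 eq_j
  | right; exact: y_eq e2 eq_j | right; exact: y_eq e3 eq_j].
all: have eq_xy : x = x' /\ y = y' by split=> //; first
  [ exact: x_eq e0 eq_j | exact: x_eq e1 eq_j | exact: y_eq e2 eq_j | exact: y_eq e3 eq_j
  | by apply: (addIr y); rewrite e4 eq_y | by apply: (addrI x); rewrite e4 eq_x ].
all: by rewrite eq_j eq_xy.1 eq_xy.2.
Qed.

Lemma array_label_exists : exists L : G * G * J -> G * J,
  forall r r' k, array_entry r k = array_entry r' k -> L r = L r' -> r = r'.
Proof.
have [f' fK f'K] : bijective (fun j => d0 j - d1 j).
  by apply: inj_card_bij; [exact: dmd | rewrite cardJ].
pose a x := d1 (f' x) - d2 (f' x).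
have a_inj : injective a.
  by move=> x x' eq_a; apply: (can_inj f'K); apply: dmd eq_a.
have addra_inj : injective (fun x => x + a x).
  move=> x x' /=; rewrite -{1}(f'K x) -{1}(f'K x') /a !addrA !subrK => eq_a.
  by apply: (can_inj f'K); apply: dmd eq_a.
exists (fun r => let: (x, y, j) := r in (y - a x, j)).
move=> [[x y] j] [[x' y'] j'] k eq_k [eq_a eq_j]; move: eq_k; rewrite -{}eq_j => {j'} eq_k.
have x_eq : x = x' -> (x, y, j) = (x', y', j).
  by move=> eq_x; move: eq_a; rewrite eq_x => /addIr ->.
have y_eq : y = y' -> (x, y, j) = (x', y', j).
  by move=> eq_y; apply: x_eq; apply: a_inj; apply: oppr_inj; apply: (addrI y); rewrite eq_a eq_y.
case: k eq_k => [[|[|[|[|[|k]]]]] lt_k] //= eq_k.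
- by apply: x_eq; apply: addIr eq_k.
- by apply: x_eq; apply: addIr eq_k.
- by apply: y_eq; apply: addIr eq_k.
- by apply: y_eq; apply: addIr eq_k.
(* In the last column, [x + y] and [y - a x] differ by [x + a x]. *)
apply/x_eq/addra_inj; rewrite /=.
have diff u w : u + a u = (u + w) - (w - a u) by rewrite opprB addrACA subrr addr0.
by rewrite (diff x y) eq_k eq_a -diff.
Qed.

End ArrayOfMatrix.

Lemma AOA_of_difference_matrix v : has_difference_matrix v -> AOA_exists 1 3 5 v.
Proof.
move=> [G [J [d [cardG cardJ dmd]]]].
have cardGJ : #|J| = #|G| by rewrite cardG.
have [L injL] := array_label_exists dmd cardGJ.
apply: (@AOA_of_inj 1 3 5 v _ G _ (array_entry d) L) => //.
- by rewrite !card_prod cardG cardJ !expnS muln1 mulnA.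
- by rewrite card_prod cardG cardJ.
- exact: array_entry_inj dmd.
by move=> c _ r r' eq_r; apply: injL (eq_r ord0).
Qed.

(** * Products, fields and cyclic groups *)

Lemma has_difference_matrixM v w :
  has_difference_matrix v -> has_difference_matrix w -> has_difference_matrix (v * w).
Proof.
move=> [G [J [d [cardG cardJ dmd]]]] [H [K [d' [cardH cardK dmd']]]].
exists (G * H)%type, (J * K)%type, (fun i j => (d i j.1, d' i j.2)).
split; rewrite ?card_prod ?cardG ?cardJ ?cardH ?cardK //.
move=> i k ne_ik [j l] [j' l'] eq_d; congr pair.
  exact: (dmd i k ne_ik) (congr1 fst eq_d).
exact: (dmd' i k ne_ik) (congr1 snd eq_d).
Qed.

Lemma field_has_difference_matrix (F : finFieldType) :
  (4 <= #|F|)%N -> has_difference_matrix #|F|.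
Proof.
move=> le4F; pose a (i : 'I_4) : F := enum_val (widen_ord le4F i).
have a_inj : injective a by move=> i k /enum_val_inj [] /val_inj.
exists F, F, (fun i j => a i * j); split=> // i k ne_ik j j' /=.
rewrite -!mulrBl; apply: mulfI.
by rewrite subr_eq0 (inj_eq a_inj).
Qed.

Lemma prime_power_has_difference_matrix p k :
  prime p -> (k == 0) || (4 <= p ^ k)%N -> has_difference_matrix (p ^ k).
Proof.
move=> p_pr; case: k => [|k] /= le4q.
  (* Order 1: the trivial group. *)
  by exists 'I_1, 'I_1, (fun _ => id); split=> [||i k _ j j' _]; rewrite ?card_ord ?ord1.
have [F _ cardF] := pPrimePowerField p_pr (ltn0Sn k).
by rewrite -cardF; apply: field_has_difference_matrix; rewrite cardF.
Qed.

Lemma Zp_mulrn_inj m n : coprime n m.+1 -> injective (fun x : 'I_m.+1 => x *+ n).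
Proof.
move=> co_nm x y /eqP; rewrite -subr_eq0 -mulrnBl Zp_mulrn => /eqP/(congr1 val) /= /eqP.
rewrite -/(dvdn _ _) Gauss_dvdl 1?coprime_sym // => dv.
apply/eqP; rewrite -subr_eq0; apply/eqP/val_inj/eqP.
by rewrite -[val _](modn_small (ltn_ord (x - y))).
Qed.

(** Two rows differ by multiplication by 1, 2 or 3, a unit modulo [m]. *)
Lemma coprime6_has_difference_matrix m : coprime m 6 -> has_difference_matrix m.
Proof.
case: m => [//|m] co_m6.
have co_d n : (0 < n < 4)%N -> coprime n m.+1.
  move=> n_range; rewrite coprime_sym (coprime_dvdr _ co_m6) //.
  by case: n n_range => [|[|[|[|]]]].
exists 'I_m.+1, 'I_m.+1, (fun i j => j *+ i); split; rewrite ?card_ord //.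
apply: difference_matrix_lt => i k lt_ik j j' /=.
rewrite -!mulrnBr 1?ltnW //; apply: Zp_mulrn_inj; apply: co_d.
by rewrite subn_gt0 lt_ik (leq_ltn_trans (leq_subr _ _)).
Qed.

(** * Orders 12 and 24, by computation *)

Lemma table_has_difference_matrix (G : finZmodType) v (t : seq (seq G)) :
  #|G| = v ->
  all (fun k => all (fun i =>
    uniq (mkseq (fun j => (nth [::] t k)`_j - (nth [::] t i)`_j) v)) (iota 0 k)) (iota 0 4) ->
  has_difference_matrix v.
Proof.
move=> cardG /allP uniq_t; exists G, 'I_v, (fun (i : 'I_4) (j : 'I_v) => (nth [::] t i)`_j).
split; rewrite ?card_ord //; apply: difference_matrix_lt => i k lt_ik j j' eq_jj'.
have k_range : val k \in iota 0 4 by rewrite mem_iota ltn_ord.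
have i_range : val i \in iota 0 k by rewrite mem_iota lt_ik.
have /mkseq_uniqP inj_ik := allP (uniq_t _ k_range) _ i_range.
by apply: val_inj; apply: inj_ik; rewrite ?inE ?ltn_ord.
Qed.

(* The tables of orders 12 and 24 were found by computer; an entry 2 ^ b * z + x
   stands for the element of Z_2 ^ b x Z_3 with Z_3 part z and binary digits x. *)
Definition decode4 (n : nat) : bool * bool * 'Z_3 := (odd n, odd n./2, inZp (n %/ 4)).

Definition decode8 (n : nat) : bool * bool * bool * 'Z_3 :=
  (odd n, odd n./2, odd n./2./2, inZp (n %/ 8)).

Lemma difference_matrix12 : has_difference_matrix 12.
Proof.
apply: (@table_has_difference_matrix _ 12 (map (map decode4)
  [:: nseq 12 0; iota 0 12;
      [:: 0; 9; 11; 2; 10; 7; 5; 8; 6; 1; 3; 4];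
      [:: 0; 11; 10; 1; 5; 9; 8; 4; 3; 6; 7; 2]]%N)).
  by rewrite !card_prod !card_bool card_ord.
by vm_compute.
Qed.

Lemma difference_matrix24 : has_difference_matrix 24.
Proof.
apply: (@table_has_difference_matrix _ 24 (map (map decode8)
  [:: nseq 24 0; iota 0 24;
      [:: 10; 8; 20; 23; 2; 9; 13; 7; 16; 11; 14; 4; 19; 0; 6; 5; 17; 18; 21; 22; 1; 3; 15; 12];
      [:: 0; 11; 6; 21; 23; 12; 17; 10; 16; 3; 22; 13; 15; 4; 9; 2; 8; 19; 14; 5; 7; 20; 1; 18]]%N)).
  by rewrite !card_prod !card_bool card_ord.
by vm_compute.
Qed.

(** * Order [3 * m], by a closed walk in a graph on five states *)

Definition walk_edges : seq (nat * nat) :=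
  [:: (0, 1); (1, 2); (2, 3); (3, 4); (4, 3); (4, 0)]%N.

(** The walk is 0, 1, 2 and then 3, 4 repeated; for odd [m] above 4 it ends in state 4, from which
    an edge returns to 0. *)
Definition walk (n : nat) : nat := (if n < 3 then n else if odd n then 3 else 4)%N.

(* Found by computer search.  The three lists of index 1, 2, 3 in the entry for a
   state are the p, q, r of the header, for e = 0, 1, 2. *)
Definition walk_table : seq (seq (seq nat)) :=
  [:: [:: [:: 0; 0; 0]; [:: 0; 1; 2]; [:: 0; 2; 1]; [:: 2; 1; 0]];
      [:: [:: 0; 0; 0]; [:: 0; 1; 2]; [:: 0; 2; 1]; [:: 0; 2; 1]];
      [:: [:: 0; 0; 0]; [:: 0; 1; 2]; [:: 0; 2; 1]; [:: 1; 0; 2]];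
      [:: [:: 0; 0; 0]; [:: 0; 1; 2]; [:: 1; 2; 1]; [:: 0; 2; 1]];
      [:: [:: 0; 0; 0]; [:: 0; 2; 1]; [:: 0; 2; 0]; [:: 2; 0; 1]]]%N.

Definition walk_entry (s k e : nat) : 'Z_3 := inZp (nth 0 (nth [::] (nth [::] walk_table s) k) e)%N.

Definition walk_diff (i k s e : nat) : 'Z_3 := walk_entry s k e - walk_entry s i e.

Lemma walk_edge m n : (4 < m)%N -> odd m -> (n < m)%N -> (walk n, walk (n.+1 %% m)) \in walk_edges.
Proof.
move=> lt4m odd_m; rewrite leq_eqVlt => /predU1P[def_m | lt_n1m].
  move: lt4m odd_m; rewrite -def_m modnn /= => lt3n /negbTE odd_n.
  by rewrite {1}/walk odd_n ltnNge ltnW.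
rewrite modn_small //; case: n lt_n1m => [|[|[|n]]] // _.
by rewrite /walk /= negbK; case: (odd n).
Qed.

(** For these pairs of rows the Z_m part of the difference is [n], [3n] or [2n]; it determines [n],
    so only [e] remains to be recovered. *)
Lemma walk_diff_inj s i k : (s < 5)%N -> (i, k) \in [:: (0, 1); (0, 3); (1, 3)]%N ->
  {in gtn 3 &, injective (walk_diff i k s)}.
Proof.
move=> lt_s ik_in; apply/mkseq_uniqP; move: ik_in; rewrite !inE.
by case: s lt_s => [|[|[|[|[|]]]]] // _ /or3P[] /eqP[-> ->]; vm_compute.
Qed.

(** These are the possible collisions between columns whose indices [n] differ by 1. *)
Lemma walk_diff_step : {in walk_edges, forall p,
  [&& walk_diff 0 2 p.1 0 != walk_diff 0 2 p.2 2,
      walk_diff 1 2 p.1 0 != walk_diff 1 2 p.2 1,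
      walk_diff 1 2 p.1 1 != walk_diff 1 2 p.2 2,
      walk_diff 2 3 p.1 1 != walk_diff 2 3 p.2 0 &
      walk_diff 2 3 p.1 2 != walk_diff 2 3 p.2 1]}.
Proof. by apply/allP; vm_compute. Qed.

(** Collisions at distance 2: the Z_m parts [n - e] of rows 1, 2 and [n + e] of rows 2, 3 agree when
    [e] runs from 0 to 2 as well. *)
Lemma walk_diff_step2 : {in walk_edges &, forall p q, p.2 = q.1 ->
  (walk_diff 1 2 p.1 0 != walk_diff 1 2 q.2 2) && (walk_diff 2 3 p.1 2 != walk_diff 2 3 q.2 0)}.
Proof.
move=> p q p_in q_in /eqP; apply/implyP; move: q q_in; apply/allP; move: p p_in.
by apply/allP; vm_compute.
Qed.

(** If [2n - e] and [2n' - e'] agree with [e], [e'] consecutive, then [n] and [n'] differ by one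
    half modulo [m], and no edge relates their states. Hence the value 2 is reserved for [e = 1] in
    every state. *)
Lemma walk_diff02_mid s e : (s < 5)%N -> (e < 3)%N ->
  (walk_diff 0 2 s e == inZp 2) = (e == 1)%N.
Proof. by case: s => [|[|[|[|[|]]]]] //; case: e => [|[|[|]]] //. Qed.

Lemma walk_lt5 n : (walk n < 5)%N.
Proof. by rewrite /walk; case: (ltnP n 3) => [lt_n3|_]; [exact: leq_trans lt_n3 _ | case: odd]. Qed.

Lemma three_has_difference_matrix m : coprime m 6 -> (4 < m)%N -> has_difference_matrix (3 * m).
Proof.
case: m => [|[|m]] // co_m6 lt4m.
have odd_m : odd m.+2 by rewrite -coprimen2 (coprime_dvdr _ co_m6).
have mulrn_inj n : (n %| 6)%N -> injective (fun x : 'I_m.+2 => x *+ n).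
  by move=> dv_n6; apply: Zp_mulrn_inj; rewrite coprime_sym (coprime_dvdr dv_n6).
pose w (n : 'I_m.+2) := walk n.
have w_step n : (w n, w (n + 1)) \in walk_edges.
  by have := walk_edge lt4m odd_m (ltn_ord n); rewrite /w /= addn1.
have w_diff_inj (i k : nat) n (e e' : 'I_3) : (i, k) \in [:: (0, 1); (0, 3); (1, 3)]%N ->
    walk_diff i k (w n) e = walk_diff i k (w n) e' -> e = e'.
  move=> ik_in eq_e; apply: val_inj.
  by apply: (walk_diff_inj (walk_lt5 n) ik_in) eq_e; apply: ltn_ord.
have ltr_e (e e' : 'I_3) : (e < e')%N -> [\/ e = 0%N :> nat /\ e' = 1%N :> nat,
    e = 1%N :> nat /\ e' = 2 :> nat | e = 0%N :> nat /\ e' = 2 :> nat].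
  by case: e e' => [[|[|[|e]]] ?] [[|[|[|e']]] ?] //= _; [constructor 1 | constructor 3 | constructor 2].
have row02 (n n' : 'I_m.+2) (e e' : 'I_3) : (e < e')%N -> n *+ 2 - e%:R = n' *+ 2 - e'%:R ->
    walk_diff 0 2 (w n) e <> walk_diff 0 2 (w n') e'.
  have mid l : walk_diff 0 2 (w l) 1 = inZp 2 by apply/eqP; rewrite walk_diff02_mid ?walk_lt5.
  move=> /ltr_e[] [-> ->] eq_n; rewrite ?mid => /eqP.
  - by rewrite walk_diff02_mid ?walk_lt5.
  - by rewrite eq_sym walk_diff02_mid ?walk_lt5.
  (* Here [e = 0] and [e' = 2]; halving is possible since [m] is odd. *)
  have -> : n' = n + 1.
    by apply: (mulrn_inj 2) => //=; apply: (addIr (- 2%:R)); rewrite -eq_n; ring.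
  by have /and5P[/negbTE->] := walk_diff_step (w_step n).
have row12 (n n' : 'I_m.+2) (e e' : 'I_3) : (e < e')%N -> n - e%:R = n' - e'%:R ->
    walk_diff 1 2 (w n) e <> walk_diff 1 2 (w n') e'.
  move=> lt_ee' eq_n; have -> : n' = n - e%:R + e'%:R by rewrite eq_n subrK.
  have /and5P[_ /eqP + /eqP + _ _] := walk_diff_step (w_step n).
  have [/eqP + _] := andP (walk_diff_step2 (w_step n) (w_step (n + 1)) erefl).
  move=> /= ne02 ne01 ne12; case: (ltr_e _ _ lt_ee') => [] [-> ->]; rewrite ?mulr0n ?mulr1n ?subr0 ?subrK //.
  - by rewrite -[2]/(1 + 1)%N natrD addrA subrK.
  by rewrite -[2]/(1 + 1)%N natrD addrA.
have row23 (n n' : 'I_m.+2) (e e' : 'I_3) : (e < e')%N -> n + e%:R = n' + e'%:R ->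
    walk_diff 2 3 (w n) e <> walk_diff 2 3 (w n') e'.
  move=> lt_ee' eq_n; have -> : n = n' + e'%:R - e%:R by rewrite -eq_n addrK.
  have /and5P[_ _ _ /eqP + /eqP +] := walk_diff_step (w_step n').
  have [_ /eqP +] := andP (walk_diff_step2 (w_step n') (w_step (n' + 1)) erefl).
  move=> /= ne02 ne10 ne21; case: (ltr_e _ _ lt_ee') => [] [-> ->] /esym; rewrite ?mulr0n ?mulr1n ?subr0 //.
  - by rewrite -[2]/(1 + 1)%N natrD addrA addrK.
  by rewrite -[2]/(1 + 1)%N natrD addrA.
pose d (k : 'I_4) (j : 'I_3 * 'I_m.+2) : 'Z_3 * 'I_m.+2 :=
  (walk_entry (w j.2) k j.1, j.2 *+ k - (if k == 2 :> nat then j.1%:R else 0)).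
exists ('Z_3 * 'I_m.+2)%type, ('I_3 * 'I_m.+2)%type, d.
split; rewrite ?card_prod ?card_ord //; apply: difference_matrix_lt => i k lt_ik [e n] [e' n'] eq_d.
have := congr1 snd eq_d; have {eq_d} : walk_diff i k (w n) e = walk_diff i k (w n') e' := congr1 fst eq_d.
have eq_pair : (e = e' -> n = n') -> ~ (e < e')%N -> ~ (e' < e)%N -> (e, n) = (e', n').
  by move=> eq_n nlt ngt; case: (ltngtP e e') => // /val_inj eq_e; rewrite (eq_n eq_e) eq_e.
(* The pairs of rows come in the order 01, 02, 03, 12, 13, 23; those with row 2 need the
   inequalities along the walk. *)
case: i k lt_ik => [[|[|[|[|i]]]] lt_i] [[|[|[|[|k]]]] lt_k] //= _ eq_w;
  rewrite ?subr0 ?mulr0n ?mulr1n ?subr0.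
- by move=> eq_n; move: eq_w; rewrite -eq_n => /w_diff_inj->.
- move=> eq_n; apply: eq_pair => [eq_e | lt_e | lt_e].
  + by apply: (mulrn_inj 2) => //=; move: eq_n; rewrite eq_e; apply: addIr.
  + exact: row02 lt_e eq_n eq_w.
  exact: row02 lt_e (esym eq_n) (esym eq_w).
- by move=> /mulrn_inj eq_n; move: eq_w; rewrite -eq_n // => /w_diff_inj->.
- have simp (x c : 'I_m.+2) : x *+ 2 - c - x = x - c by ring.
  rewrite !simp => eq_n; apply: eq_pair => [eq_e | lt_e | lt_e].
  + by move: eq_n; rewrite eq_e; apply: addIr.
  + exact: row12 lt_e eq_n eq_w.
  exact: row12 lt_e (esym eq_n) (esym eq_w).
- have simp (x : 'I_m.+2) : x *+ 3 - x = x *+ 2 by ring.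
  by rewrite !simp => /mulrn_inj eq_n; move: eq_w; rewrite -eq_n // => /w_diff_inj->.
have simp (x c : 'I_m.+2) : x *+ 3 - (x *+ 2 - c) = x + c by ring.
rewrite !simp => eq_n; apply: eq_pair => [eq_e | lt_e | lt_e].
+ by move: eq_n; rewrite eq_e; apply: addIr.
+ exact: row23 lt_e eq_n eq_w.
exact: row23 lt_e (esym eq_n) (esym eq_w).
Qed.

End DifferenceMatrices.

(** * Assembly from the factorization of [v] *)

Lemma difference_matrix_exists v : 4 <= v -> v %% 4 != 2 -> has_difference_matrix v.
Proof.
move=> le4v v_mod4; have v_gt0 : 0 < v by apply: leq_trans le4v.
have [u co2u def_v] := pfactor_coprime (isT : prime 2) v_gt0.
have u_gt0 : 0 < u by move: v_gt0; rewrite def_v muln_gt0 => /andP[].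
have [m co3m def_u] := pfactor_coprime (isT : prime 3) u_gt0.
move: (logn 2 v) (logn 3 u) def_v def_u => b a def_v def_u.
have co_m6 : coprime m 6.
  rewrite (coprimeMr m 2 3) ![coprime m _]coprime_sym co3m andbT.
  by move: co2u; rewrite def_u coprimeMr => /andP[].
have dm_m := coprime6_has_difference_matrix co_m6.
have b_neq1 : b != 1.
  apply: contra v_mod4 => /eqP def_b; rewrite def_v def_b expn1 -(odd_double_half u).
  by rewrite -coprime2n co2u mulnDl -muln2 -mulnA addnC modnMDl.
have dm_2 k : k != 1 -> has_difference_matrix (2 ^ k).
  by move=> k_neq1; apply: prime_power_has_difference_matrix => //;
     case: k k_neq1 => [|[|k]] // _; rewrite -[4]/(2 ^ 2) leq_pexp2l.
have [a1 | a_neq1] := eqVneq a 1; last first.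
  (* With [a] different from 1, [3 ^ a] is 1 or at least 9, so a field or the trivial group
     serves. *)
  rewrite def_v def_u; do 2?apply: has_difference_matrixM => //; last exact: dm_2.
  apply: prime_power_has_difference_matrix => //.
  by case: a a_neq1 {def_u} => [|[|a]] // _; apply: (@leq_trans (3 ^ 2)); rewrite ?leq_pexp2l.
rewrite def_v def_u a1 expn1; have [lt4m | ] := ltnP 4 m.
  by apply: has_difference_matrixM; [rewrite mulnC; apply: three_has_difference_matrix | apply: dm_2].
(* Being at most 4 and prime to 6, [m] is 1, so [v] is 3 times a power of 2. *)
case: m co_m6 def_u {co3m dm_m} => [|[|[|[|[|m]]]]] // _ def_u _; rewrite mul1n.
case: b b_neq1 def_v => [|[|[|[|b]]]] // _ def_v.
- by move: le4v; rewrite def_v def_u a1.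
- exact: difference_matrix12.
- exact: difference_matrix24.
(* Splitting off 12 leaves a power of 2 that is at least 4. *)
rewrite -[b.+4]/(2 + b.+2) expnD mulnA.
by apply: has_difference_matrixM; [exact: difference_matrix12 | exact: dm_2].
Qed.

Theorem theorem2p11 (v : nat) (hv : 4 <= v) (hmod : v %% 4 != 2) :
  AOA_exists 1 3 5 v.
Proof. exact/AOA_of_difference_matrix/difference_matrix_exists. Qed.
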